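(* Let $(\Omega,\mathcal{F})$ be a measurable space, let $\mathcal{P}$ be the set of all probability measures on $(\Omega,\mathcal{F})$, let $H$ be an affine set of signed measures on $(\Omega,\mathcal{F})$ with finite total variation, and suppose that $\mathcal{M}:=\mathcal{P}\cap H$ is nonempty. For $p\in\mathcal{M}$, the following statements are equivalent. (i) $p$ is $\ll$-minimal in $\mathcal{M}$. (ii) For every $p'\in\mathcal{M}\setminus\{p\}$, every $q\in\mathcal{M}$ with $p\ll q$ and $p'\ll q$, and every convex function $\varphi\colon[0,\infty)\to\mathbb{R}$ satisfying $$\varphi(1)=0,\quad\varphi'_+(0)=-\infty,\quad D_\varphi(p\,\|\,q)<\infty,\quad D_\varphi(p'\,\|\,q)<\infty,$$ one has $$\lim_{\lambda\uparrow1}\frac{D_\varphi(\lambda p+(1-\lambda)p'\,\|\,q)-D_\varphi(p\,\|\,q)}{1-\lambda}=-\infty.$$ In particular, $\lambda=1$ is a strict local maximizer of the map $[0,1]\to[0,\infty)$, $\lambda\mapsto D_\varphi(\lambda p+(1-\lambda)p'\,\|\,q)$.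
   Context: An affine set $H$ is a subset of the vector space of signed measures of finite total variation that contains $\lambda\mu+(1-\lambda)\nu$ for all $\mu,\nu\in H$ and $\lambda\in\mathbb{R}$. We write $p\ll q$ for absolute continuity and $\frac{\mathrm{d}p}{\mathrm{d}q}\colon\Omega\to[0,\infty)$ for the Radon-Nikodym density. An element $p\in\mathcal{M}$ is called $\ll$-minimal in $\mathcal{M}$ if there exists no $p'\in\mathcal{M}\setminus\{p\}$ with $p'\ll p$. For a convex function $\varphi\colon[0,\infty)\to\mathbb{R}$ with $\varphi(1)=0$ and $p,q\in\mathcal{P}$ with $p\ll q$, the $\varphi$-divergence of $p$ with respect to $q$ is $D_\varphi(p\,\|\,q):=\int_\Omega\varphi\big(\frac{\mathrm{d}p}{\mathrm{d}q}\big)\,\mathrm{d}q$. Moreover, $\varphi'_+(0):=\lim_{s\downarrow0}\frac{\varphi(s)-\varphi(0)}{s}\in[-\infty,\infty)$. The point $\lambda=1$ is a strict local maximizer of $f\colon[0,1]\to\mathbb{R}$ if there is $\delta>0$ with $f(\lambda)<f(1)$ for all $\lambda\in[0,1]\cap(1-\delta,1)$. *)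

(* Defs.v *)
From HB Require Import structures.
From mathcomp Require Import all_boot all_order all_algebra.
From mathcomp Require Import all_classical all_reals all_analysis.

Set Implicit Arguments.
Unset Strict Implicit.
Unset Printing Implicit Defensive.

Import Order.TTheory GRing.Theory Num.Theory.
Import numFieldNormedType.Exports.

Local Open Scope classical_set_scope.
Local Open Scope ring_scope.
Local Open Scope charge_scope.

(* The library's (signed) measures are functions on all of [set T], constrained
   on measurable sets only, so [=] distinguishes functions that represent the
   same mathematical measure. *)
Definition same_measure d (T : measurableType d) (R : realType)
    (mu nu : set T -> \bar R) : Prop :=
  forall A : set T, measurable A -> mu A = nu A.

Definition affine_comb d (T : measurableType d) (R : realType) (l : R)
    (mu nu : {charge set T -> \bar R}) : {charge set T -> \bar R} :=
  cadd (cscale l mu) (cscale (1 - l) nu).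

(* Charges are finite on measurable sets and sigma-additive, i.e. signed measures
   of finite total variation.  Quantifying over every representative [rho] of the
   combination makes [H] a set of signed measures: it is invariant under
   [same_measure] (take [l = 1]). *)
Definition affine_set d (T : measurableType d) (R : realType)
    (H : set (charge T R)) : Prop :=
  forall (mu nu rho : {charge set T -> \bar R}) (l : R),
    H mu -> H nu -> same_measure rho (affine_comb l mu nu) -> H rho.

Definition probabilities_in d (T : measurableType d) (R : realType)
    (H : set (charge T R)) : set (probability T R) :=
  [set p : probability T R | H (charge_of_finite_measure p)].

Definition ll_minimal d (T : measurableType d) (R : realType)
    (M : set (probability T R)) (p : probability T R) : Prop :=
  M p /\ ~ exists p' : probability T R,
    [/\ M p', ~ same_measure p' p & p' `<< p].

Definition mixture d (T : measurableType d) (R : realType) (l : R)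
    (p p' : probability T R) : {charge set T -> \bar R} :=
  affine_comb l (charge_of_finite_measure p) (charge_of_finite_measure p').

(* The library's derivative is real-valued everywhere but, for a nonnegative
   charge, nonnegative only almost everywhere; the positive part is a version
   with values in [0, +oo[. *)
Definition density d (T : measurableType d) (R : realType)
    (p : {charge set T -> \bar R}) (q : probability T R) (x : T) : R :=
  Num.max 0 (fine (('d p '/d q) x)).

(* The first argument is a charge so that [mixture l p p'] makes sense for every
   real [l]; the divergence is meaningful when it is a probability measure
   dominated by [q]. *)
Definition phi_divergence d (T : measurableType d) (R : realType) (phi : R -> R)
    (p : {charge set T -> \bar R}) (q : probability T R) : \bar R :=
  (\int[q]_x (phi (density p q x))%:E)%E.

(* A convex function on [0, +oo[ is given by any extension [phi] to the whole
   line: [density] only takes nonnegative values. *)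
Definition convex_on_nonneg (R : realType) (phi : R -> R) : Prop :=
  @convex_function R R^o `[0, +oo[ phi.

Definition right_derivative0_ninfty (R : realType) (phi : R -> R) : Prop :=
  ((phi s - phi 0) / s)%:E @[s --> 0^'+] --> -oo%E.

Definition admissible d (T : measurableType d) (R : realType)
    (M : set (probability T R)) (p p' q : probability T R) (phi : R -> R) : Prop :=
  [/\ [/\ M p', ~ same_measure p' p, M q, p `<< q & p' `<< q],
      convex_on_nonneg phi, phi 1 = 0, right_derivative0_ninfty phi &
      (phi_divergence phi (charge_of_finite_measure p) q < +oo)%E /\
      (phi_divergence phi (charge_of_finite_measure p') q < +oo)%E].

Definition steep_descent d (T : measurableType d) (R : realType)
    (p p' q : probability T R) (phi : R -> R) : Prop :=
  ((phi_divergence phi (mixture l p p') q -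
    phi_divergence phi (charge_of_finite_measure p) q) * ((1 - l)^-1)%:E)%E
    @[l --> 1^'-] --> -oo%E.

Definition strict_local_maximizer_at1 (R : realType) (f : R -> R) : Prop :=
  exists2 delta : R, 0 < delta &
    forall l : R, 0 <= l <= 1 -> 1 - delta < l < 1 -> f l < f 1.

(* Main.v *)
Require Import Defs.
From HB Require Import structures.
From mathcomp Require Import all_boot all_order all_algebra.
From mathcomp Require Import all_classical all_reals all_analysis.
From mathcomp Require Import measurable_realfun ring lra.

Import Order.TTheory GRing.Theory Num.Theory.
Import numFieldNormedType.Exports.

Local Open Scope classical_set_scope.
Local Open Scope ring_scope.

(** Write [f] and [g] for the densities of [p] and [p'] with respect to [q]; the
    density of the mixture is [l * f + (1 - l) * g] almost everywhere.

    Minimality implies steepness.  If [p] is minimal, then [p'] is not absolutely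
    continuous with respect to [p], so [p'] charges the set where [f] vanishes
    ([escaping_mass]).  Hence there are [0 < a <= b] and a set [B] of positive
    [q]-measure on which [f = 0] and [a <= g <= b].  On [B] the difference
    quotient of the integrand is [(phi (e * g) - phi 0) / e] with [e = 1 - l];
    since the slopes of [phi] at [0] increase and tend to minus infinity, it is
    below any given [- M] for small [e].  Off [B], convexity bounds the quotient
    by the integrable function [phi g - phi f].  Integrating, the quotient of
    the divergences is eventually at most a constant minus [M * q B]
    ([convex_mix_steep]).

    Steepness implies minimality.  If some [p'] in the family differs from [p]
    and [p' << p], take [q = p] and [phi t = 1 - sqrt t].  Then the divergence
    of [p] vanishes and that of every mixture is nonnegative by Jensen's
    inequality, so the quotient cannot tend to minus infinity.

    Finiteness of the divergence along the segment holds because [phi] lies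
    above a supporting line at [1] and, on the segment, below the chord; and a
    quotient that is eventually negative says precisely that [l = 1] is a strict
    local maximizer. *)

Set Implicit Arguments.
Unset Strict Implicit.

(** * Convex functions on the half-line *)

Section ConvexReal.
Context {R : realType} {phi : R -> R}.

Lemma convex_on_nonnegP : convex_on_nonneg phi <->
  forall x y t : R, 0 <= x -> 0 <= y -> 0 <= t <= 1 ->
  phi (t * x + (1 - t) * y) <= t * phi x + (1 - t) * phi y.
Proof.
split=> [cphi x y t x0 y0 /andP[t0 t1]|cphi t x y].
  have xI : x \in (`[0, +oo[%classic : set R) by rewrite inE/= in_itv/= x0.
  have yI : y \in (`[0, +oo[%classic : set R) by rewrite inE/= in_itv/= y0.
  exact: (cphi (Itv01 t0 t1) x y xI yI).
rewrite !inE/= !in_itv/= !andbT => x0 y0.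
by apply: cphi => //; rewrite ge0 le1.
Qed.

Hypothesis cphi : convex_on_nonneg phi.
Let cvx := convex_on_nonnegP.1 cphi.

Lemma convex_slope0_le (s t : R) : 0 < s -> s <= t ->
  (phi s - phi 0) / s <= (phi t - phi 0) / t.
Proof.
move=> s0 st; have t0 := lt_le_trans s0 st.
have st1 : 0 <= s / t <= 1.
  by rewrite divr_ge0 ?(ltW s0) ?(ltW t0)//= ler_pdivrMr// mul1r.
have := cvx (ltW t0) (lexx 0) st1.
rewrite mulr0 addr0 divfK ?gt_eqF// => h.
rewrite ler_pdivrMr// mulrAC.
have -> : (phi t - phi 0) * s / t = s / t * (phi t - phi 0) by ring.
lra.
Qed.

(** The slope [c] is the right derivative of [phi] at [1], obtained as the
    infimum of the slopes of the chords to the right of [1]; chords to the left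
    bound it from below. *)
Lemma convex_supporting_line1 :
  exists c : R, forall t : R, 0 <= t -> phi 1 + c * (t - 1) <= phi t.
Proof.
pose S := [set (phi t - phi 1) / (t - 1) | t in [set t | 1 < t]].
have chord s t : 0 <= s -> s < 1 -> 1 < t ->
    (phi 1 - phi s) / (1 - s) <= (phi t - phi 1) / (t - 1).
  move=> s0 s1 t1.
  have ts : 0 < t - s by lra.
  have w01 : 0 <= (t - 1) / (t - s) <= 1.
    by rewrite divr_ge0 ?ler_pdivrMr// ?mul1r; lra.
  have := cvx s0 (ltW (lt_trans ltr01 t1)) w01.
  have -> : (t - 1) / (t - s) * s + (1 - (t - 1) / (t - s)) * t = 1.
    by field; lra.
  have -> : (t - 1) / (t - s) * phi s + (1 - (t - 1) / (t - s)) * phi t =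
            ((t - 1) * phi s + (1 - s) * phi t) / (t - s) by field; lra.
  rewrite ler_pdivlMr// => h.
  rewrite ler_pdivrMr; last lra.
  rewrite mulrAC ler_pdivlMr; last lra.
  lra.
have lbS s : 0 <= s -> s < 1 -> lbound S ((phi 1 - phi s) / (1 - s)).
  by move=> s0 s1 _ [t t1 <-]; exact: chord.
have S0 : S !=set0 by exists ((phi 2 - phi 1) / (2 - 1)), 2 => //=; lra.
exists (inf S) => t t0.
have [t1|t1|->] := ltgtP t 1; last by rewrite subrr mulr0 addr0.
- have := lb_le_inf S0 (lbS t t0 t1).
  rewrite ler_pdivrMr; last lra.
  lra.
- have : inf S <= (phi t - phi 1) / (t - 1).
    apply: ge_inf; last by exists t.
    by exists ((phi 1 - phi 0) / (1 - 0)); apply: lbS; lra.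
  rewrite ler_pdivlMr; last lra.
  lra.
Qed.

(** Sublevel sets of a convex function are intervals, even if it jumps at [0]. *)
Lemma measurable_convex : measurable_fun (`[0, +oo[%classic : set R) phi.
Proof.
pose I : set R := `[0, +oo[%classic.
have mI : measurable I by exact: measurable_itv.
apply: (measurability (@RGenOInfty.G R)) => [|/= _ [_] [r] -> <-].
  exact: RGenOInfty.measurableE.
suff mS : measurable (I `&` [set x | phi x <= r]).
  rewrite [X in measurable X](_ : _ = I `\` (I `&` [set x | phi x <= r])).
    exact: measurableD.
  apply/seteqP; split => x /=; rewrite /I/= !in_itv/= !andbT.
    by move=> [x0 rx]; split => // -[_]; rewrite leNgt rx.
  by move=> [x0 h]; split => //; rewrite ltNge; apply/negP => xr; apply: h.
apply: is_interval_measurable => x y /= [+ xr] [+ yr] z /andP[xz zy].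
rewrite /I/= !in_itv/= !andbT => x0 y0.
have z0 : 0 <= z by exact: le_trans xz.
split => //.
have [xy|xy] := eqVneq x y.
  by have -> : z = x by lra.
have dxy : 0 < y - x by rewrite subr_gt0 lt_neqAle xy (le_trans xz zy).
have w01 : 0 <= (y - z) / (y - x) <= 1.
  by rewrite divr_ge0 ?ler_pdivrMr// ?mul1r; lra.
have := cvx x0 y0 w01.
have -> : (y - z) / (y - x) * x + (1 - (y - z) / (y - x)) * y = z.
  by field; lra.
move/le_trans; apply.
set w := (y - z) / (y - x) in w01 *.
have /andP[w0 w1] := w01.
have : w * phi x <= w * r by exact: ler_wpM2l.
have : (1 - w) * phi y <= (1 - w) * r by apply: ler_wpM2l => //; lra.
lra.
Qed.

End ConvexReal.

(** * Integration against a probability measure *)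

Section Integration.
Context {d : measure_display} {T : measurableType d} {R : realType}.
Context {q : probability T R}.

(** The integral is the integral of the positive part minus that of the negative
    part; the minorant makes the latter finite, so the former is finite too. *)
Lemma integrable_minorant (F G : T -> R) :
  measurable_fun setT F -> q.-integrable setT (EFin \o G) ->
  (forall x, G x <= F x) -> (\int[q]_x (F x)%:E < +oo)%E ->
  q.-integrable setT (EFin \o F).
Proof.
move=> mF iG GF intF.
have mEF : measurable_fun setT (EFin \o F) by exact/measurable_EFinP.
have mp := measurable_funepos mEF; have mn := measurable_funeneg mEF.
have Fneg : (\int[q]_x (EFin \o F)^\- x < +oo)%E.
  have := integral_funeneg_lt_pinfty measurableT iG; apply: le_lt_trans.
  apply: ge0_le_integral => //.
  - by apply: measurable_funeneg; exact: measurable_int iG.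
  - move=> x _; rewrite !funenegE/= -!EFin_max lee_fin.
    by rewrite ge_max !le_max lerN2 GF lexx orbT.
apply/integrableP; split=> //; rewrite -/(abse \o (EFin \o F)) fune_abse.
rewrite ge0_integralD//; apply: lte_add_pinfty => //.
rewrite ltNge leye_eq; apply/negP => /eqP Fpos.
move: intF; rewrite integralE -/(comp EFin F) Fpos.
by rewrite addye ?ltxx// eqe_oppLR/= lt_eqF.
Qed.

Lemma integrable_lincomb (u v : T -> R) (s t : R) :
  q.-integrable setT (EFin \o u) -> q.-integrable setT (EFin \o v) ->
  q.-integrable setT (fun x => (s * u x + t * v x)%:E).
Proof.
move=> iu iv.
rewrite (_ : (fun _ => _) =
  (fun x => s%:E * (u x)%:E) \+ (fun x => t%:E * (v x)%:E))%E//.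
by apply: integrableD => //; exact: integrableZl.
Qed.

Lemma integrable_between (F L U : T -> R) :
  measurable_fun setT F ->
  q.-integrable setT (EFin \o L) -> q.-integrable setT (EFin \o U) ->
  (forall x, L x <= F x <= U x) -> q.-integrable setT (EFin \o F).
Proof.
move=> mF iL iU LFU.
apply: (le_integrable measurableT (g := EFin \o (fun x => `|L x| + `|U x|))).
- exact/measurable_EFinP.
- move=> x _ /=; rewrite lee_fin (ger0_norm (addr_ge0 _ _))//.
  have /andP[LF FU] := LFU x.
  have := ler_norm (U x); have := ler_norm (- L x); rewrite normrN.
  have := normr_ge0 (U x); have := normr_ge0 (L x).
  by rewrite ler_norml => *; apply/andP; split; lra.
- rewrite (_ : _ \o _ = (EFin \o (Num.norm \o L)) \+ (EFin \o (Num.norm \o U)))%E//.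
  by apply: integrableD => //; exact: integrable_norm.
Qed.

(** The set where [g] is positive is the countable union of the sets where
    [(n + 1)^-1 <= g <= n + 1], so they cannot all be null inside [N]. *)
Lemma level_set_of_positive_integral (N : set T) (g : T -> R) :
  measurable N -> measurable_fun setT g -> (forall x, 0 <= g x) ->
  (0 < \int[q]_(x in N) (g x)%:E)%E ->
  exists B (a b : R), [/\ measurable B, B `<=` N, (0 < q B)%E, 0 < a &
    forall x, B x -> a <= g x <= b].
Proof.
move=> mN mg g0 ig.
pose B n := N `&` (g @^-1` `[n.+1%:R^-1, n.+1%:R]).
have mB n : measurable (B n).
  by apply: measurableI => //; rewrite -[X in measurable X]setTI; exact: mg.
have [[n qn]|qB0] := pselect (exists n, q (B n) != 0%E).
  exists (B n), n.+1%:R^-1, n.+1%:R; split => //.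
  - by move=> x [].
  - by rewrite lt0e qn measure_ge0.
  - by move=> x [_]; rewrite /= in_itv.
exfalso; move: ig.
have mgN : measurable_fun N (EFin \o g).
  by apply/measurable_EFinP; exact: measurable_funTS.
suff : ae_eq q N (EFin \o g) (cst 0%E).
  move=> /(ae_eq_integral_abs _ mN mgN)/=.
  under eq_integral do rewrite ger0_norm ?g0//.
  by move=> ->; rewrite ltxx.
suff: q.-negligible (\bigcup_n B n).
  apply: negligibleS.
  move=> x /= /not_implyP[Nx /eqP gx0].
  have gx : 0 < g x by rewrite lt0r g0 andbT; apply: contra gx0 => /eqP ->.
  (* This [n] makes [n + 1] exceed both [g x] and its inverse. *)
  have hn := truncnS_gt (g x + (g x)^-1).
  set n := Num.truncn _ in hn; exists n => //; split => //=.
  have gV : 0 < (g x)^-1 by rewrite invr_gt0.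
  rewrite in_itv/=; apply/andP; split; last by apply: ltW; apply: lt_trans hn; lra.
  by rewrite invf_ple ?posrE//; apply: ltW; apply: lt_trans hn; lra.
apply: negligible_bigcup => n; apply/negligibleP; first exact: mB.
by apply/eqP; apply: contrapT => /negP qBn; apply: qB0; exists n.
Qed.

Context {phi : R -> R}.
Hypothesis cphi : convex_on_nonneg phi.

Lemma measurable_convex_comp (h : T -> R) :
  measurable_fun setT h -> (forall x, 0 <= h x) ->
  measurable_fun setT (phi \o h).
Proof.
move=> mh h0; apply: (measurable_comp _ _ (measurable_convex cphi) mh).
  exact: measurable_itv.
by move=> _ [x _ <-] /=; rewrite in_itv/= h0.
Qed.

(** The supporting line at [1] provides the integrable minorant, so a divergence
    that is not plus infinity is an honest finite integral. *)
Lemma integrable_convex_comp (h : T -> R) :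
  q.-integrable setT (EFin \o h) -> (forall x, 0 <= h x) ->
  (\int[q]_x (phi (h x))%:E < +oo)%E ->
  q.-integrable setT (EFin \o (phi \o h)).
Proof.
move=> ih h0.
have mh : measurable_fun setT h by apply/measurable_EFinP; case/integrableP: ih.
have [c hc] := convex_supporting_line1 cphi.
apply: (@integrable_minorant _ (fun x => (phi 1 - c) * 1 + c * h x)).
- exact: measurable_convex_comp.
- by apply: integrable_lincomb => //; exact: finite_measure_integrable_cst.
- by move=> x; have /= := hc _ (h0 x); lra.
Qed.

(** Integrating the supporting line at [1]: its linear part has integral [0]
    because [h] has mean [1]. *)
Lemma jensen1 (h : T -> R) :
  q.-integrable setT (EFin \o h) -> (forall x, 0 <= h x) ->
  (\int[q]_x (h x)%:E = 1)%E -> q.-integrable setT (EFin \o (phi \o h)) ->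
  ((phi 1)%:E <= \int[q]_x (phi (h x))%:E)%E.
Proof.
move=> ih h0 h1 iphi.
have [c hc] := convex_supporting_line1 cphi.
have -> : (phi 1)%:E = (\int[q]_x ((phi 1 - c)%:E + c%:E * (h x)%:E))%E.
  rewrite integralD//; last exact: integrableZl; last first.
    exact: finite_measure_integrable_cst.
  rewrite integral_cst// integralZl// h1 mule1.
  by rewrite [X in (_ * X + _)%E]probability_setT mule1 -EFinD subrK.
apply: le_integral => //.
- apply: integrableD => //; first exact: finite_measure_integrable_cst.
  exact: integrableZl.
- move=> x _; rewrite -EFinM -EFinD lee_fin; have := hc _ (h0 x); lra.
Qed.

End Integration.

(** * Mixtures of two densities *)

Section Mixtures.
Context {d : measure_display} {T : measurableType d} {R : realType}.
Context {q : probability T R} {phi : R -> R}.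
Hypothesis cphi : convex_on_nonneg phi.
Let cvx := convex_on_nonnegP.1 cphi.
Context {f g : T -> R}.
Hypotheses (f0 : forall x, 0 <= f x) (g0 : forall x, 0 <= g x).
Hypotheses (iF : q.-integrable setT (EFin \o f)).
Hypotheses (iG : q.-integrable setT (EFin \o g)).
Hypotheses (ipF : q.-integrable setT (EFin \o (phi \o f))).
Hypotheses (ipG : q.-integrable setT (EFin \o (phi \o g))).

Lemma mix_ge0 (l : R) x : 0 <= l <= 1 -> 0 <= l * f x + (1 - l) * g x.
Proof.
by move=> /andP[l0 l1]; rewrite addr_ge0// mulr_ge0// subr_ge0.
Qed.

(** The composition lies between the supporting line at [1] and the chord. *)
Lemma integrable_convex_mix (l : R) : 0 <= l <= 1 ->
  q.-integrable setT (fun x => (phi (l * f x + (1 - l) * g x))%:E).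
Proof.
move=> l01; pose h x := l * f x + (1 - l) * g x.
have ih : q.-integrable setT (EFin \o h) by exact: integrable_lincomb.
have h0 x : 0 <= h x by exact: mix_ge0.
have mh : measurable_fun setT h by apply/measurable_EFinP; case/integrableP: ih.
have [c hc] := convex_supporting_line1 cphi.
apply: (@integrable_between _ _ _ q (phi \o h) (fun x => (phi 1 - c) * 1 + c * h x)
  (fun x => l * phi (f x) + (1 - l) * phi (g x))).
- exact: measurable_convex_comp.
- by apply: integrable_lincomb => //; exact: finite_measure_integrable_cst.
- exact: integrable_lincomb.
- move=> x; apply/andP; split; last exact: cvx.
  by have /= := hc _ (h0 x); lra.
Qed.

(** The quantitative heart of the argument, for a fixed [l].  On [B] the integrand
    drops by at least [(1 - l) * M], since the slope of [phi] at
    [(1 - l) * g x] is at most the one at [(1 - l) * b] and [g x >= a]; off [B]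
    convexity bounds the change by [(1 - l) * (phi (g x) - phi (f x))]. *)
Lemma Rintegral_convex_mix_le (B : set T) (a b l M : R) :
  measurable B -> 0 < a ->
  (forall x, B x -> f x = 0 /\ a <= g x <= b) ->
  0 < l -> l < 1 -> 0 <= M ->
  (phi ((1 - l) * b) - phi 0) / ((1 - l) * b) <= - (M / a) ->
  \int[q]_x phi (l * f x + (1 - l) * g x) - \int[q]_x phi (f x) <=
  (1 - l) * (\int[q]_(x in ~` B) (phi (g x) - phi (f x)) - M * fine (q B)).
Proof.
move=> mB a0 fgB l0 l1 M0 slope.
have l01 : 0 <= l <= 1 by rewrite !ltW.
have mBC := measurableC mB.
pose D x := phi (g x) - phi (f x).
have iD : q.-integrable setT (EFin \o (D \_ (~` B))).
  rewrite -restrict_EFin; apply/(integrable_mkcond _ mBC).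
  apply: (integrableS measurableT) => //.
  rewrite (_ : _ \o _ = (EFin \o (phi \o g)) \- (EFin \o (phi \o f)))%E//.
  exact: integrableB.
have i1 : q.-integrable setT (EFin \o \1_B) by exact: integrable_indic.
(* [(1 - l) * w] majorizes the pointwise change of the integrand. *)
pose w x := 1 * (D \_ (~` B)) x + (- M) * \1_B x.
have iw : q.-integrable setT (EFin \o w) by exact: integrable_lincomb.
have <- : \int[q]_x w x = \int[q]_(x in ~` B) D x - M * fine (q B).
  rewrite RintegralD//; last 2 first.
  - rewrite (_ : _ \o _ = fun x => (1%:E * ((D \_ (~` B)) x)%:E))%E//.
    exact: integrableZl.
  - rewrite (_ : _ \o _ = fun x => ((- M)%:E * (\1_B x)%:E))%E//.
    exact: integrableZl.
  rewrite !RintegralZl// mul1r mulNr -Rintegral_mkcond; congr (_ - _ * _).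
  by rewrite /Rintegral integral_indic// setIT.
have iwl : q.-integrable setT (EFin \o (fun x => (1 - l) * w x)).
  rewrite (_ : _ \o _ = fun x => ((1 - l)%:E * (w x)%:E))%E//.
  exact: integrableZl.
rewrite lerBlDl -RintegralZl// -RintegralD//.
apply: le_Rintegral => //; first exact: integrable_convex_mix.
  by rewrite (_ : _ \o _ = (EFin \o (phi \o f)) \+
    (EFin \o (fun x => ((1 - l) * w x)%R)))%E//; exact: integrableD.
move=> x _; rewrite /w patchE indicE.
have [xB|xB] := boolP (x \in B).
- have [fx0 /andP[ag gb]] := fgB x (set_mem xB).
  rewrite memNset; last by move=> /=; apply; exact: set_mem.
  rewrite fx0 mulr0 add0r !mulr0 add0r mulr1.
  have l1' : 0 < 1 - l by rewrite subr_gt0.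
  have s0 : 0 < (1 - l) * g x by rewrite mulr_gt0// (lt_le_trans a0).
  have := convex_slope0_le cphi s0 (ler_wpM2l (ltW l1') gb).
  move=> /le_trans/(_ slope).
  rewrite ler_pdivrMr// => h.
  suff : - (M / a) * ((1 - l) * g x) <= (1 - l) * - M by lra.
  rewrite mulrCA ler_pM2l// mulNr lerN2 -[leLHS](divfK (lt0r_neq0 a0)).
  by apply: ler_wpM2l => //; rewrite divr_ge0// ltW.
- rewrite mem_set; last by move=> /mem_set; apply/negP.
  rewrite mulr0 addr0 mul1r /D /=.
  by have := cvx (f0 x) (g0 x) l01; lra.
Qed.

(** Choose [M] so that the constant in the previous bound falls below [A]; its
    slope condition then holds as soon as [(1 - l) * b] is below a single point
    [s] with small enough slope, because slopes at [0] increase. *)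
Lemma convex_mix_steep (B : set T) (a b : R) :
  right_derivative0_ninfty phi ->
  measurable B -> (0 < q B)%E -> 0 < a ->
  (forall x, B x -> f x = 0 /\ a <= g x <= b) ->
  forall A : R, \forall l \near 1^'-,
  (\int[q]_x phi (l * f x + (1 - l) * g x) - \int[q]_x phi (f x)) / (1 - l) <= A.
Proof.
move=> dphi mB qB a0 fgB A.
have qBf : 0 < fine (q B).
  by rewrite fine_gt0// qB/= (le_lt_trans (probability_le1 q mB))// ltry.
have b0 : 0 < b.
  have [x Bx] : B !=set0.
    by apply/set0P; apply: contraTneq qB => ->; rewrite measure0 ltxx.
  by have [_ /andP[ag gb]] := fgB x Bx; rewrite (lt_le_trans a0)// (le_trans ag).
set K := \int[q]_(x in ~` B) (phi (g x) - phi (f x)).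
pose M := Num.max 0 ((K - A) / fine (q B)).
have M0 : 0 <= M by rewrite le_max lexx.
have KM : K - M * fine (q B) <= A.
  have : (K - A) / fine (q B) <= M by rewrite le_max lexx orbT.
  by rewrite ler_pdivrMr// => h; lra.
have /cvgeNyPle/(_ (- (M / a))) dM := dphi.
have [s sM s0] : exists2 s, (phi s - phi 0) / s <= - (M / a) & 0 < s.
  near (0 : R)^'+ => s; exists s.
    by rewrite -lee_fin; near: s.
  by near: s; exact: nbhs_right_gt.
near=> l.
have l1 : l < 1 by near: l; exact: nbhs_left_lt.
have l0 : 0 < l by near: l; apply: nbhs_left_gt.
have ls : 1 - s / b < l.
  by near: l; apply: nbhs_left_gt; rewrite ltrBlDr ltrDl divr_gt0.
have l1' : 0 < 1 - l by rewrite subr_gt0.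
rewrite ler_pdivrMr// [A * _]mulrC.
apply: le_trans (ler_wpM2l (ltW l1') KM).
apply: (@Rintegral_convex_mix_le B a b l M) => //.
apply: le_trans sM; apply: (convex_slope0_le cphi (mulr_gt0 l1' b0)).
by rewrite -ler_pdivlMr// lerBlDr -lerBlDl ltW.
Unshelve. all: by end_near. Qed.

End Mixtures.

(** * Radon-Nikodym densities *)

Local Open Scope charge_scope.

Section Densities.
Context {d : measure_display} {T : measurableType d} {R : realType}.
Context {q : probability T R}.
Implicit Types (nu : {charge set T -> \bar R}) (p : probability T R).

Lemma density_ge0 nu x : 0 <= density nu q x.
Proof. by rewrite /density le_max lexx. Qed.

Lemma measurable_density nu : nu `<< q -> measurable_fun setT (density nu q).
Proof.
by move=> nuq; apply: measurable_maxr => //; exact: measurableT_comp.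
Qed.

Lemma measurable_density_zeros nu : nu `<< q ->
  measurable [set x | density nu q x = 0].
Proof.
move=> /measurable_density mf; rewrite -[X in measurable X]setTI.
exact: (mf measurableT [set 0]%classic (measurable_set1 0)).
Qed.

(** Nonnegativity of the derivative of a nonnegative measure, up to a null set, is
    read off the everywhere nonnegative version for sigma-finite measures. *)
Lemma density_ae_eq p : p `<< q ->
  ae_eq q setT (EFin \o density (charge_of_finite_measure p) q)
    ('d (charge_of_finite_measure p) '/d q).
Proof.
move=> pq; have := ae_eq_Radon_Nikodym_SigmaFinite pq measurableT.
apply: filterS => x /(_ I) e _; rewrite /= /density -e.
rewrite (max_idPr _) ?fineK//; first exact: Radon_Nikodym_SigmaFinite.f_fin_num.
by rewrite fine_ge0// Radon_Nikodym_SigmaFinite.f_ge0.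
Qed.

Lemma integrable_density p : p `<< q ->
  q.-integrable setT (EFin \o density (charge_of_finite_measure p) q).
Proof.
move=> pq; apply/integrableP; split.
  by apply/measurable_EFinP; exact: measurable_density.
have /integrableP[m i] := @Radon_Nikodym_integrable _ _ _
  (charge_of_finite_measure p) q pq.
apply: le_lt_trans i; apply: ge0_le_integral => //.
- apply: measurableT_comp => //; apply/measurable_EFinP.
  exact: measurable_density.
- exact: measurableT_comp.
- move=> x _; rewrite /= ger0_norm ?density_ge0// /density.
  have pq' : charge_of_finite_measure p `<< q := pq.
  rewrite -[in leRHS](fineK (Radon_Nikodym_fin_num x pq')) lee_fin.
  by rewrite ge_max normr_ge0 ler_norm.
Qed.

Lemma integral_density p A : p `<< q -> measurable A ->
  (\int[q]_(x in A) (density (charge_of_finite_measure p) q x)%:E = p A)%E.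
Proof.
move=> pq mA; have pq' : charge_of_finite_measure p `<< q := pq.
rewrite -[RHS]/(charge_of_finite_measure p A) (Radon_Nikodym_integral pq' mA).
apply: ae_eq_integral => //.
- apply/measurable_EFinP; apply: measurable_funTS; exact: measurable_density.
- apply: measurable_funTS.
  exact: measurable_int (Radon_Nikodym_integrable pq').
- exact: (ae_eq_subset (@subsetT _ A) (density_ae_eq pq)).
Qed.

Lemma mixture_dominates p p' (l : R) : p `<< q -> p' `<< q ->
  mixture l p p' `<< q.
Proof. by move=> pq p'q; apply: dominates_cadd; apply: dominates_cscalel. Qed.

(** The positive part in [density] disappears because the combination of the two
    densities is nonnegative for [l] in the unit interval. *)
Lemma density_mixture p p' (l : R) : p `<< q -> p' `<< q -> 0 <= l <= 1 ->
  ae_eq q setT (density (mixture l p p') q) (fun x =>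
    l * density (charge_of_finite_measure p) q x +
    (1 - l) * density (charge_of_finite_measure p') q x).
Proof.
move=> pq0 p'q0 l01.
have pq : charge_of_finite_measure p `<< q := pq0.
have p'q : charge_of_finite_measure p' `<< q := p'q0.
have lpq := dominates_cscalel l pq; have lp'q := dominates_cscalel (1 - l) p'q.
have h1 := Radon_Nikodym_cadd measurableT lpq lp'q.
have h2 := Radon_Nikodym_cscale l measurableT pq.
have h3 := Radon_Nikodym_cscale (1 - l) measurableT p'q.
have h4 := density_ae_eq pq0; have h5 := density_ae_eq p'q0.
apply: filterS2 (filterI h1 (filterI h2 h3)) (filterI h4 h5) => x.
move=> [/(_ I) e1 [/(_ I) e2 /(_ I) e3]] [/(_ I) e4 /(_ I) e5] _.
rewrite {1}/density e1 e2 e3 -e4 -e5 /=.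
apply/max_idPr; by apply: mix_ge0 l01 => y; exact: density_ge0.
Qed.

Lemma phi_divergence_mixture (phi : R -> R) p p' (l : R) :
  convex_on_nonneg phi -> p `<< q -> p' `<< q -> 0 <= l <= 1 ->
  phi_divergence phi (mixture l p p') q =
  (\int[q]_x (phi (l * density (charge_of_finite_measure p) q x +
    (1 - l) * density (charge_of_finite_measure p') q x))%:E)%E.
Proof.
move=> cphi pq p'q l01; apply: ae_eq_integral => //.
- apply/measurable_EFinP; apply: (measurable_convex_comp cphi).
    by apply: measurable_density; exact: mixture_dominates.
  by move=> x; exact: density_ge0.
- apply/measurable_EFinP; apply: (measurable_convex_comp cphi
    (h := fun x => l * density (charge_of_finite_measure p) q x +
      (1 - l) * density (charge_of_finite_measure p') q x)).
    by apply: measurable_funD; apply: measurable_funM => //; exact: measurable_density.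
  by move=> x; apply: mix_ge0 => // y; exact: density_ge0.
- by apply: filterS (density_mixture pq p'q l01) => x /[apply] ->.
Qed.

End Densities.

(** * The squared Hellinger divergence *)

Section Hellinger.
Context {R : realType}.

(** The associated divergence, one minus the integral of the square root of the
    density, is the squared Hellinger distance.  It is finite for every
    dominated pair, although the slope of [hellinger] at [0] is infinite. *)
Definition hellinger (t : R) : R := 1 - Num.sqrt t.

Lemma convex_hellinger : convex_on_nonneg hellinger.
Proof.
apply/convex_on_nonnegP => x y t x0 y0 /andP[t0 t1]; rewrite /hellinger.
suff : t * Num.sqrt x + (1 - t) * Num.sqrt y <=
  Num.sqrt (t * x + (1 - t) * y) by lra.
set a := Num.sqrt x; set b := Num.sqrt y.
have ab0 : 0 <= t * a + (1 - t) * b.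
  by rewrite addr_ge0// mulr_ge0 ?sqrtr_ge0// subr_ge0.
rewrite -[leLHS](ger0_norm ab0) -sqrtr_sqr ler_wsqrtr//.
rewrite -[x](sqr_sqrtr x0) -[y](sqr_sqrtr y0) -/a -/b -subr_ge0.
have -> : t * a ^+ 2 + (1 - t) * b ^+ 2 - (t * a + (1 - t) * b) ^+ 2 =
  t * (1 - t) * (a - b) ^+ 2 by ring.
apply: mulr_ge0; last exact: sqr_ge0.
by apply: mulr_ge0 => //; rewrite subr_ge0.
Qed.

Lemma hellinger1 : hellinger 1 = 0.
Proof. by rewrite /hellinger sqrtr1 subrr. Qed.

Lemma right_derivative0_hellinger : right_derivative0_ninfty hellinger.
Proof.
apply/cvgeNyPle => A; pose M := `|A| + 1.
have M0 : 0 < M by rewrite ltr_wpDl.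
near=> s.
have s0 : 0 < s by near: s; exact: nbhs_right_gt.
have sM : s < M ^- 2.
  by near: s; apply: nbhs_right_lt; rewrite invr_gt0 exprn_gt0.
have rs0 : 0 < Num.sqrt s by rewrite sqrtr_gt0.
have rM : Num.sqrt s < M^-1.
  rewrite -[ltRHS](@ger0_norm _ M^-1) ?invr_ge0 ?ltW// -sqrtr_sqr exprVn.
  by rewrite ltr_sqrt// invr_gt0 exprn_gt0.
rewrite lee_fin /hellinger sqrtr0.
rewrite -[in X in _ / X](sqr_sqrtr (ltW s0)).
have -> : (1 - Num.sqrt s - (1 - 0)) / Num.sqrt s ^+ 2 = - (Num.sqrt s)^-1.
  by field; rewrite gt_eqF.
have : M <= (Num.sqrt s)^-1 by rewrite -[M]invrK lef_pV2 ?posrE ?invr_gt0// ltW.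
have := ler_norm (- A); rewrite normrN /M; lra.
Unshelve. all: by end_near. Qed.

End Hellinger.

(** * Divergences between probability measures *)

Section Divergence.
Context {d : measure_display} {T : measurableType d} {R : realType}.
Implicit Types p q : probability T R.

Lemma hellinger_divergence_lty p q : p `<< q ->
  (phi_divergence hellinger (charge_of_finite_measure p) q < +oo)%E.
Proof.
move=> pq; pose f := density (charge_of_finite_measure p) q.
have iF : q.-integrable setT (EFin \o f) by exact: integrable_density.
have f0 x : 0 <= f x by exact: density_ge0.
apply: integrable_lty => //.
(* Bounds from [0 <= sqrt t <= 1 + t]. *)
apply: (@integrable_between _ _ _ _ (hellinger \o f)
  (fun x => 0 * 1 + -1 * f x) (fun x => 1 * 1 + 0 * f x)).
- apply: (measurable_convex_comp convex_hellinger) => //.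
  exact: measurable_density.
- by apply: integrable_lincomb => //; exact: finite_measure_integrable_cst.
- by apply: integrable_lincomb => //; exact: finite_measure_integrable_cst.
- move=> x; rewrite /= /hellinger.
  have := sqrtr_ge0 (f x); have := sqr_sqrtr (f0 x).
  set a := Num.sqrt (f x) => fE a0; rewrite -fE.
  by apply/andP; split; nra.
Qed.

(** The constant [1] is a version of the derivative of [p] with respect to itself,
    by uniqueness of the derivative. *)
Lemma phi_divergence_self (phi : R -> R) p : convex_on_nonneg phi ->
  phi 1 = 0 -> phi_divergence phi (charge_of_finite_measure p) p = 0%E.
Proof.
move=> cphi phi1; have pp : p `<< p by [].
have pp' : charge_of_finite_measure p `<< p := pp.
have p1 : ae_eq p setT ('d (charge_of_finite_measure p) '/d p) (cst 1%E).
  apply: integral_ae_eq => //; first exact: Radon_Nikodym_integrable.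
  by move=> E _ mE; rewrite -(Radon_Nikodym_integral pp' mE) integral_cst// mul1e.
transitivity (\int[p]_x (cst 0%E x : \bar R))%E; last by rewrite integral0.
apply: ae_eq_integral => //.
  apply/measurable_EFinP; apply: (measurable_convex_comp cphi).
    exact: measurable_density.
  by move=> x; exact: density_ge0.
apply: filterS p1 => x /(_ I) e _.
by rewrite /density e /= (max_idPr _)// phi1.
Qed.

Lemma phi_divergence_integrable (phi : R -> R) p q : convex_on_nonneg phi ->
  p `<< q -> (phi_divergence phi (charge_of_finite_measure p) q < +oo)%E ->
  q.-integrable setT
    (EFin \o (phi \o density (charge_of_finite_measure p) q)).
Proof.
move=> cphi pq D; apply: (integrable_convex_comp cphi) => //.
  exact: integrable_density.
by move=> x; exact: density_ge0.
Qed.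

(** If [p'] gave no mass to the zeros of the density of [p], then it would be
    absolutely continuous with respect to [p]: a [p]-null set is, up to a
    [q]-null set, contained in those zeros. *)
Lemma escaping_mass p p' q : p `<< q -> p' `<< q -> ~ p' `<< p ->
  (0 < \int[q]_(x in [set x | density (charge_of_finite_measure p) q x = 0%R])
    (density (charge_of_finite_measure p') q x)%:E)%E.
Proof.
move=> pq p'q np'p; set f := density (charge_of_finite_measure p) q.
have mf : measurable_fun setT f by exact: measurable_density.
have mN : measurable [set x | f x = 0] by exact: measurable_density_zeros.
rewrite integral_density// lt0e measure_ge0 andbT.
apply/eqP => p'N; apply: np'p; apply/null_content_dominatesP => A mA pA.
have qA : q (A `\` [set x | f x = 0]) = 0%E.
  have mfA : measurable_fun A (EFin \o f).
    by apply/measurable_EFinP; exact: measurable_funTS.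
  have : ae_eq q A (EFin \o f) (cst 0%E).
    apply/(ae_eq_integral_abs _ mA mfA).
    under eq_integral do rewrite /= ger0_norm ?density_ge0//.
    by rewrite integral_density.
  move=> /negligible_null_set; apply => //; first exact: measurableD.
  by move=> x [Ax fx] /= /(_ Ax)[].
have p'D : p' (A `\` [set x | f x = 0]) = 0%E.
  by move/null_content_dominatesP: p'q; apply => //; exact: measurableD.
have p'I : p' (A `&` [set x | f x = 0]) = 0%E.
  by apply: (subset_measure0 _ _ (@subIsetr _ _ _) p'N) => //; exact: measurableI.
by rewrite (measureDI p' mA mN) [X in (X + _)%E]p'D [X in (_ + X)%E]p'I adde0.
Qed.

Section Admissible.
Variables (M : set (probability T R)) (p p' q : probability T R) (phi : R -> R).
Hypothesis adm : admissible M p p' q phi.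
Let f := density (charge_of_finite_measure p) q.
Let g := density (charge_of_finite_measure p') q.
Let cphi : convex_on_nonneg phi. Proof. by case: adm. Qed.
Let pq : p `<< q. Proof. by case: adm => -[]. Qed.
Let p'q : p' `<< q. Proof. by case: adm => -[]. Qed.
Let f0 x : 0 <= f x. Proof. exact: density_ge0. Qed.
Let g0 x : 0 <= g x. Proof. exact: density_ge0. Qed.
Let iF : q.-integrable setT (EFin \o f).
Proof. exact: integrable_density. Qed.
Let iG : q.-integrable setT (EFin \o g).
Proof. exact: integrable_density. Qed.
Let ipF : q.-integrable setT (EFin \o (phi \o f)).
Proof. by apply: phi_divergence_integrable => //; case: adm => _ _ _ _ []. Qed.
Let ipG : q.-integrable setT (EFin \o (phi \o g)).
Proof. by apply: phi_divergence_integrable => //; case: adm => _ _ _ _ []. Qed.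

(** For admissible data all divergences on the segment are finite, which turns the
    quotient in the extended reals into one of real numbers. *)
Lemma phi_divergence_left_Rintegral :
  phi_divergence phi (charge_of_finite_measure p) q =
  (\int[q]_x phi (f x))%:E.
Proof. by rewrite fineK//; apply: integrable_fin_num => //. Qed.

Lemma phi_divergence_mixture_Rintegral (l : R) : 0 <= l <= 1 ->
  phi_divergence phi (mixture l p p') q =
  (\int[q]_x phi (l * f x + (1 - l) * g x))%:E.
Proof.
move=> l01; rewrite phi_divergence_mixture// fineK//.
by apply: integrable_fin_num => //; exact: integrable_convex_mix.
Qed.

Lemma phi_divergence_mixture_ge0 (l : R) : 0 <= l <= 1 ->
  (0 <= phi_divergence phi (mixture l p p') q)%E.
Proof.
move=> l01; rewrite phi_divergence_mixture//.
have ih : q.-integrable setT (EFin \o (fun x => l * f x + (1 - l) * g x)).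
  exact: integrable_lincomb.
have phi1 : phi 1 = 0 by case: adm.
have := @jensen1 _ _ _ q phi cphi (fun x => l * f x + (1 - l) * g x) ih.
rewrite phi1; apply.
- by move=> x; exact: mix_ge0.
- under eq_integral do rewrite EFinD !EFinM.
  rewrite integralD//; try exact: integrableZl.
  rewrite !integralZl// !integral_density// !probability_setT !mule1.
  by rewrite -EFinD subrKC.
- exact: integrable_convex_mix.
Qed.

(** The mass that [p'] puts where [p] has none produces the infinite slope. *)
Lemma not_dominated_steep_descent : ~ p' `<< p -> steep_descent p p' q phi.
Proof.
move=> np'p.
have mN : measurable [set x | f x = 0] by exact: measurable_density_zeros.
have mg : measurable_fun setT g by exact: measurable_density.
have [B [a [b [mB BN qB a0 gab]]]] := level_set_of_positive_integral mN mg g0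
  (escaping_mass pq p'q np'p).
have dphi : right_derivative0_ninfty phi by case: adm.
apply/cvgeNyPle => A.
have fgB x : B x -> f x = 0 /\ a <= g x <= b.
  by move=> Bx; split; [exact: BN|exact: gab].
have := convex_mix_steep cphi f0 g0 iF iG ipF ipG dphi mB qB a0 fgB A.
move=> H; near=> l.
have l01 : 0 <= l <= 1.
  apply/andP; split; apply: ltW; near: l; last exact: nbhs_left_lt.
  exact: nbhs_left_gt.
rewrite phi_divergence_mixture_Rintegral// phi_divergence_left_Rintegral.
by rewrite -EFinB -EFinM lee_fin; near: l.
Unshelve. all: by end_near. Qed.

Lemma steep_descent_strict_local_maximizer : steep_descent p p' q phi ->
  strict_local_maximizer_at1
    (fun l : R => fine (phi_divergence phi (mixture l p p') q)).
Proof.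
move=> /cvgeNyPlt/(_ 0)[e /= e0 he]; exists e => // l l01 /andP[le l1].
have := he l.
rewrite /= !phi_divergence_mixture_Rintegral ?ler01 ?lexx//.
rewrite phi_divergence_left_Rintegral -EFinB -EFinM lte_fin.
rewrite pmulr_llt0 ?invr_gt0 ?subr_gt0//= subr_lt0.
(* At [l = 1] the mixture integrand is that of [p]. *)
under [in X in _ -> _ < X]eq_Rintegral do rewrite subrr mul0r mul1r addr0.
by apply => //; rewrite gtr0_norm ?subr_gt0//; lra.
Qed.

End Admissible.
End Divergence.

Unset Implicit Arguments.
Set Strict Implicit.

Theorem theorem2p5 (d : measure_display) (T : measurableType d) (R : realType)
    (H : set (charge T R)) (H_affine : affine_set H)
    (M_nonempty : probabilities_in H !=set0)
    (p : probability T R) (Mp : probabilities_in H p) :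
  (ll_minimal (probabilities_in H) p <->
   (forall (p' q : probability T R) (phi : R -> R),
      admissible (probabilities_in H) p p' q phi ->
      steep_descent p p' q phi)) /\
  (forall (p' q : probability T R) (phi : R -> R),
     admissible (probabilities_in H) p p' q phi ->
     (forall l : R, 0 <= l <= 1 ->
        (0 <= phi_divergence phi (mixture l p p') q < +oo)%E) /\
     (steep_descent p p' q phi ->
      strict_local_maximizer_at1
        (fun l : R => fine (phi_divergence phi (mixture l p p') q)))).
Proof.
split; last first.
  move=> p' q phi adm; split=> [l l01|].
    rewrite (phi_divergence_mixture_ge0 adm)//=.
    by rewrite (phi_divergence_mixture_Rintegral adm)// ltry.
  exact: steep_descent_strict_local_maximizer adm.
split=> [[_ pmin] p' q phi adm|steep].
  apply: (not_dominated_steep_descent adm) => p'p.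
  by apply: pmin; exists p'; case: adm => -[].
split=> // -[p' [Mp' p'Np p'p]].
have adm : admissible (probabilities_in H) p p' p hellinger.
  split; first by split.
  - exact: convex_hellinger.
  - exact: hellinger1.
  - exact: right_derivative0_hellinger.
  - by split; exact: hellinger_divergence_lty.
have /cvgeNyPlt/(_ 0) lt0 := steep _ _ _ adm.
near (1 : R)^'- => l.
have l1 : l < 1 by near: l; exact: nbhs_left_lt.
have l0 : 0 < l by near: l; exact: nbhs_left_gt.
have : ((phi_divergence hellinger (mixture l p p') p -
    phi_divergence hellinger (charge_of_finite_measure p) p) *
    ((1 - l)^-1)%:E < 0)%E by near: l.
rewrite (phi_divergence_self _ convex_hellinger hellinger1) sube0.
rewrite ltNge mule_ge0//.
  by apply: (phi_divergence_mixture_ge0 adm); rewrite !ltW.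
by rewrite lee_fin invr_ge0 subr_ge0 ltW.
Unshelve. all: by end_near. Qed.
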